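(* Let $S$ be a Polish space, let $\Sigma=\mathcal{B}$ be its Borel $\sigma$-algebra, and let $\mathrm{M}$ be the set of all nonnegative real-valued (hence finite) measures on $\Sigma$. Let $k\ge1$ be an integer, let $f_1,\dots,f_k\colon S\to\mathbb{R}$ be Borel-measurable functions, and $\mathbf{f}=(f_1,\dots,f_k)$. For $c\in\mathbb{R}^k$ let $\mathrm{M}_{\mathbf{f},c}=\{\mu\in\mathrm{M}\colon \mathbf{f}\in L^1(\mu),\ \int_S\mathbf{f}\,d\mu=c\}$. Then $$\operatorname{ex}\mathrm{M}_{\mathbf{f},c}=\Delta_{\mathbf{f}}^{(k)}\cap\mathrm{M}_{\mathbf{f},c}\qquad\text{for all }c\in\mathbb{R}^k.$$
   Context: A Polish space is a separable completely metrizable topological space. One writes $\mathbf{f}\in L^1(\mu)$ if every $f_j$ is $\mu$-integrable, and $\int_S\mathbf{f}\,d\mu=(\int_S f_1\,d\mu,\dots,\int_S f_k\,d\mu)$. For a set $\mathrm{K}\subseteq\mathrm{M}$, $\operatorname{ex}\mathrm{K}$ is the set of all extreme points of $\mathrm{K}$: $\mu\in\operatorname{ex}\mathrm{K}$ iff $\mu\in\mathrm{K}$ and for any $t\in(0,1)$ and $\nu_0,\nu_1\in\mathrm{K}$ with $(1-t)\nu_0+t\nu_1=\mu$ one has $\nu_0=\nu_1$. For $s\in S$, $\delta_s$ is the Dirac probability measure at $s$. The set $\Delta_{\mathbf{f}}^{(k)}$ consists of all measures $\sum_{i=1}^m a_i\delta_{s_i}$ with $m\in\{0,1,\dots,k\}$,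 $(a_1,\dots,a_m)\in(0,\infty)^m$, $(s_1,\dots,s_m)\in S^m$ such that the vectors $\mathbf{f}(s_1),\dots,\mathbf{f}(s_m)$ are linearly independent; for $m=0$ the sum is the zero measure and the conditions are regarded as trivially satisfied, so $0\in\Delta_{\mathbf{f}}^{(k)}$. *)

(* Defs.v *)
From HB Require Import structures.
From mathcomp Require Export all_boot all_order all_algebra.
From mathcomp Require Export all_classical all_reals all_analysis.

Set Implicit Arguments.
Unset Strict Implicit.
Unset Printing Implicit Defensive.

Import Order.TTheory GRing.Theory Num.Theory.
Import numFieldNormedType.Exports.

Local Open Scope classical_set_scope.
Local Open Scope ring_scope.

Definition separable_space (S : topologicalType) : Prop :=
  exists2 D : set S, countable D & dense D.

(* [dist] is a metric that induces the given topology of [S]. *)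
Definition compatible_metric (R : realType) (S : topologicalType)
    (dist : S -> S -> R) : Prop :=
  [/\ forall x y, dist x y = 0 <-> x = y,
      forall x y, dist x y = dist y x,
      forall x y z, dist x z <= dist x y + dist y z &
      forall (x : S) (A : set S),
        nbhs x A <-> exists2 e : R, 0 < e & [set y | dist x y < e] `<=` A].

Definition complete_metric (R : realType) (S : topologicalType)
    (dist : S -> S -> R) : Prop :=
  forall u : nat -> S,
    (forall e : R, 0 < e -> exists N : nat, forall m n : nat,
       (N <= m)%N -> (N <= n)%N -> dist (u m) (u n) < e) ->
    exists l : S, u @ \oo --> l.

Definition completely_metrizable (R : realType) (S : topologicalType) : Prop :=
  exists2 dist : S -> S -> R, compatible_metric dist & complete_metric dist.

Definition polish_space (R : realType) (S : topologicalType) : Prop :=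
  separable_space S /\ completely_metrizable R S.

Notation borel S := (g_sigma_algebraType (@open S)).

(* A library measure is a function on all subsets, and its values on
   nonmeasurable sets are arbitrary; measures on the sigma-algebra are therefore
   identified when they agree on measurable sets. *)
Definition eq_measure d (T : measurableType d) (R : realType)
    (mu nu : set T -> \bar R) : Prop :=
  forall A, measurable A -> mu A = nu A.

Definition extreme_points d (T : measurableType d) (R : realType)
    (K : set {finite_measure set T -> \bar R}) :
    set {finite_measure set T -> \bar R} :=
  [set mu | K mu /\
    forall (t : R) (nu0 nu1 : {finite_measure set T -> \bar R}),
      0 < t < 1 -> K nu0 -> K nu1 ->
      eq_measure (fun A => (1 - t)%:E * nu0 A + t%:E * nu1 A)%E mu ->
      eq_measure nu0 nu1].

(* Finite measures [mu] with [f] in L^1(mu) and integral of [f] equal to [c]. *)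
Definition moment_measures d (T : measurableType d) (R : realType) (k : nat)
    (f : 'I_k -> T -> R) (c : 'rV[R]_k) :
    set {finite_measure set T -> \bar R} :=
  [set mu | forall j : 'I_k,
    mu.-integrable setT (EFin \o f j) /\
    (\int[mu]_x (f j x)%:E = (c 0 j)%:E)%E].

Definition discrete_measures d (T : measurableType d) (R : realType) (k : nat)
    (f : 'I_k -> T -> R) : set {finite_measure set T -> \bar R} :=
  [set mu | exists (m : nat) (a : 'I_m -> R) (s : 'I_m -> T),
    [/\ (m <= k)%N,
        forall i, 0 < a i,
        free [tuple (\row_(j < k) f j (s i) : 'rV[R]_k) | i < m] &
        eq_measure mu (fun A => \sum_(i < m) (a i)%:E * \d_(s i) A)%E]].

(* Main.v *)
(** Let [mu] be extreme.  If finitely many disjoint measurable sets [B i] have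
    positive measure and [\sum_i a i * \int[mu]_(B i) f = 0], then multiplying
    [mu] on each [B i] by [1 + eps * a i], resp. [1 - eps * a i], gives two
    measures with the same moments and midpoint [mu], so [a = 0].  Hence the
    vectors [\int[mu]_(B i) f] are linearly independent and there are at most
    [k] of them.  Small balls around distinct points of the support are such
    sets, so the support has at most [k] points; by separability [mu] lives on
    its support, and the same fact applied to the singletons gives the
    independence of the [f (s i)].  Conversely, measures whose mixture is
    carried by a finite set are carried by it, and their weights are determined
    by the moments when the [f (s i)] are independent. *)
From HB Require Import structures.
Require Import Defs.
From mathcomp Require Import measurable_realfun ring lra.
Import Order.TTheory GRing.Theory Num.Theory.
Import numFieldNormedType.Exports.
Local Open Scope classical_set_scope.
Local Open Scope ring_scope.

Set Implicit Arguments.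
Unset Strict Implicit.
Unset Printing Implicit Defensive.

(** * Rescaling a finite measure on the cells of a finite measurable partition *)

Section reweighting.
Context d (T : measurableType d) (R : realType).
Variables (mu : {finite_measure set T -> \bar R}) (n : nat) (A : nat -> set T).
Hypotheses (mA : forall i, measurable (A i)) (tA : trivIset setT A).
Hypothesis covA : \big[setU/set0]_(i < n) A i = setT.

Lemma integral_partition (nu : {measure set T -> \bar R}) (g : T -> R) :
  measurable_fun setT g ->
  (\int[nu]_x (g x)%:E = \sum_(i < n) \int[nu]_(x in A i) (g x)%:E)%E.
Proof.
move=> mg; rewrite -[X in integral _ X]covA -(big_mkord xpredT A).
rewrite -(big_mkord xpredT (fun i => \int[nu]_(x in A i) (g x)%:E)%E).
rewrite integral_bigsetU_EFin//.
- by rewrite iota_uniq.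
- exact: sub_trivIset tA.
- by apply/measurable_EFinP; apply: measurable_funTS.
Qed.

Lemma measure_partition B : measurable B ->
  mu B = (\sum_(i < n) mu (B `&` A i))%E.
Proof.
move=> mB; rewrite -[in LHS](setIT B) -covA big_distrr.
rewrite (measure_bigsetU mu (F := fun i => B `&` A i))//.
- by move=> i; apply: measurableI.
- exact: trivIset_setIl.
Qed.

Variable w : nat -> {nonneg R}.

Lemma reweighting_exists : exists nu : {finite_measure set T -> \bar R},
  forall B, nu B = (\sum_(i < n) (w i)%:num%:E * mu (B `&` A i))%E.
Proof.
pose nu : {measure set T -> \bar R} :=
  msum (fun i => mscale (w i) (mrestr mu (mA i))) n.
have nufin : fin_num_fun nu.
  move=> B mB; rewrite /nu/= /msum; apply/sum_fin_numP => i _ _.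
  by rewrite fin_numM// fin_num_measure//; apply: measurableI.
pose H := Measure_isFinite.Build _ _ _ nu nufin.
pose nu' : {finite_measure set T -> \bar R} := HB.pack (Measure.sort nu) H.
by exists nu'.
Qed.

Variable nu : {finite_measure set T -> \bar R}.
Hypothesis nuE :
  forall B, nu B = (\sum_(i < n) (w i)%:num%:E * mu (B `&` A i))%E.

Lemma reweighting_sub B i : (i < n)%N -> measurable B -> B `<=` A i ->
  nu B = ((w i)%:num%:E * mu B)%E.
Proof.
move=> ltin mB BA; rewrite nuE (bigD1 (Ordinal ltin))//= big1 ?adde0.
  by rewrite (setIidl BA).
move=> j neji; suff -> : B `&` A j = set0 by rewrite measure0 mule0.
rewrite -subset0 => x [/BA Aix Ajx]; move/trivIsetP: tA => /(_ j i I I neji).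
by rewrite -subset0; apply.
Qed.

(** Inside the cell [A i], [nu] is [mu] scaled by [w i]. Nonnegativity of [g] replaces integrability
    here, so this applies to absolute values and to positive and negative parts alike. *)
Lemma ge0_integral_reweighting_sub (g : T -> \bar R) i : (i < n)%N ->
  measurable_fun setT g -> (forall x, 0 <= g x)%E ->
  (\int[nu]_(x in A i) g x = (w i)%:num%:E * \int[mu]_(x in A i) g x)%E.
Proof.
move=> ltin mg g0; rewrite (eq_measure_integral (mscale (w i) mu)).
  by rewrite ge0_integral_mscale//; apply: measurable_funTS.
by move=> B mB BA; exact: (reweighting_sub ltin mB BA).
Qed.

Lemma integrable_reweighting (g : T -> R) :
  mu.-integrable setT (EFin \o g) -> nu.-integrable setT (EFin \o g).
Proof.
move=> ig; have /measurable_EFinP mg := measurable_int _ ig.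
apply/integrableP; split; first exact/measurable_EFinP.
rewrite (@integral_partition _ (fun x => `|g x|)); last exact: measurableT_comp.
apply: lte_sum_pinfty => i _; rewrite ge0_integral_reweighting_sub//.
  rewrite lte_mul_pinfty//.
  have /integrableP[_] : mu.-integrable (A i) (EFin \o g) by apply: integrableS ig.
  by [].
by apply/measurable_EFinP; apply: measurableT_comp.
Qed.

Lemma integral_reweighting (g : T -> R) :
  mu.-integrable setT (EFin \o g) ->
  (\int[nu]_x (g x)%:E =
   \sum_(i < n) (w i)%:num%:E * \int[mu]_(x in A i) (g x)%:E)%E.
Proof.
move=> ig; have mg := measurable_int _ ig.
rewrite integral_partition; last exact/measurable_EFinP.
apply: eq_bigr => i _; rewrite integralE [in RHS]integralE.
have igi : mu.-integrable (A i) (EFin \o g) by apply: integrableS ig.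
rewrite !ge0_integral_reweighting_sub//; last 2 first.
- exact: measurable_funeneg.
- exact: measurable_funepos.
rewrite [RHS]muleBr//; exact: integrable_add_def.
Qed.

End reweighting.

(** * Independence of the moments of an extreme measure over disjoint sets *)

Lemma extreme_moments_indep d (T : measurableType d) (R : realType) (k : nat)
    (f : 'I_k -> T -> R) (c : 'rV[R]_k) (mu : {finite_measure set T -> \bar R})
    (m : nat) (B : 'I_m -> set T) (a : 'I_m -> R) :
  extreme_points (moment_measures f c) mu ->
  (forall i, measurable (B i)) -> trivIset setT B ->
  (forall i, 0 < mu (B i))%E ->
  (forall j, \sum_(i < m) a i * fine (\int[mu]_(x in B i) (f j x)%:E)%E = 0) ->
  forall i, a i = 0.
Proof.
move=> [Kmu exmu] mB tB posB sum0 i0.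
(* The sets [B i], shifted by one, are completed to a partition by their complement as cell [0].
   There [L] is 0, so the perturbation leaves [mu] unchanged off the [B i]. *)
pose A q := if q is i.+1 then oapp B set0 (insub i) else ~` \bigcup_i B i.
pose L q := if q is i.+1 then oapp a 0 (insub i) else 0.
have mA q : measurable (A q).
  case: q => [|q] /=; last by case: insubP => *; [exact: mB|exact: measurable0].
  apply: measurableC; apply: fin_bigcup_measurable => //; exact: finite_finset.
have AS (i : 'I_m) : A i.+1 = B i by rewrite /A valK.
have LS (i : 'I_m) : L i.+1 = a i by rewrite /L valK.
have tA : trivIset setT A.
  have A0S i : A 0%N `&` A i.+1 = set0.
    rewrite -subset0 => x [/= nBx]; case: insubP => //= j _ _ Bjx.
    by apply: nBx; exists j.
  apply/trivIsetP => -[|i] [|j] _ _ // ij; first by rewrite setIC.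
  rewrite /A; case: insubP => [i' _ i'E|_]; last by rewrite set0I.
  case: insubP => [j' _ j'E|_]; last by rewrite setI0.
  move/trivIsetP: tB; apply => //; apply: contra ij => /eqP ij.
  by rewrite -i'E -j'E ij.
have covA : \big[setU/set0]_(q < m.+1) A q = setT.
  rewrite -subTset => x _; rewrite -bigcup_mkord.
  have [[i _ Bix]|nBx] := pselect ((\bigcup_i B i) x).
    by exists i.+1; [rewrite /= ltnS|rewrite AS].
  by exists 0%N.
(* Small enough that [eps * a i] has absolute value at most 1, which keeps both families of weights
   nonnegative; the summand 1 keeps the denominator positive. *)
pose eps := (1 + \sum_(i < m) `|a i|)^-1.
have suma0 : 0 <= \sum_(i < m) `|a i| by apply: sumr_ge0.
have eps_gt0 : 0 < eps by rewrite invr_gt0 ltr_pwDl.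
have epsL q : `|eps * L q| <= 1.
  rewrite normrM gtr0_norm// mulrC ler_pdivrMr ?mul1r ?ltr_pwDl//.
  case: q => [|q] /=; first by rewrite normr0 addr_ge0.
  case: insubP => /= [i _ _|_]; last by rewrite normr0 addr_ge0.
  by rewrite (bigD1 i)//= addrCA ler_wpDr// addr_ge0// sumr_ge0.
have w_ge0 (b : bool) q : 0 <= 1 + (-1) ^+ b * (eps * L q).
  have := epsL q; rewrite ler_norml => /andP[? ?].
  by case: b; rewrite ?expr1 ?expr0; lra.
pose w b q := NngNum (w_ge0 b q).
have [nu0 nu0E] := reweighting_exists mu m.+1 mA (w false).
have [nu1 nu1E] := reweighting_exists mu m.+1 mA (w true).
(* The perturbation changes the [j]-th moment by plus or minus [eps] times the sum that [sum0]
   declares zero. *)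
have Knu b (nu : {finite_measure set T -> \bar R}) : (forall C, nu C =
    \sum_(q < m.+1) (w b q)%:num%:E * mu (C `&` A q))%E ->
    moment_measures f c nu.
  move=> nuE j; have [fj_int fj_eq] := Kmu j; split.
    exact: (integrable_reweighting mA tA covA nuE).
  have ifA q : mu.-integrable (A q) (EFin \o f j) by apply: integrableS fj_int.
  have mfj : measurable_fun setT (f j).
    by apply/measurable_EFinP; exact: measurable_int fj_int.
  pose v q := fine (\int[mu]_(x in A q) (f j x)%:E)%E.
  have vE q : (\int[mu]_(x in A q) (f j x)%:E = (v q)%:E)%E.
    by rewrite fineK//; apply: integrable_fin_num (ifA q).
  rewrite (integral_reweighting mA tA covA nuE)// -fj_eq.
  rewrite (integral_partition mA tA covA mu)//.
  under eq_bigr do rewrite vE -EFinM.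
  under [RHS]eq_bigr do rewrite vE.
  rewrite !sumEFin; congr EFin => /=.
  under eq_bigr do rewrite mulrDl mul1r -!mulrA.
  rewrite big_split/= -!mulr_sumr.
  rewrite [X in _ * (_ * X)]big_ord_recl [L _]/(0 : R) mul0r add0r.
  under [X in _ * (_ * X)]eq_bigr do rewrite LS /v AS.
  by rewrite sum0 !mulr0 addr0.
have half01 : 0 < (2^-1 : R) < 1 by apply/andP; split; lra.
have /exmu/(_ (B i0) (mB i0)) :
    eq_measure (fun C => (1 - 2^-1)%:E * nu0 C + (2^-1)%:E * nu1 C)%E mu.
  move=> C mC; rewrite nu0E nu1E (measure_partition _ mA tA covA mC).
  pose r q := fine (mu (C `&` A q)).
  have rE q : mu (C `&` A q) = (r q)%:E.
    by rewrite fineK// fin_num_measure//; apply: measurableI.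
  under eq_bigr do rewrite rE -EFinM.
  under [X in (_ + _ * X)%E]eq_bigr do rewrite rE -EFinM.
  under [RHS]eq_bigr do rewrite rE.
  rewrite !sumEFin -!EFinM -EFinD; congr EFin.
  rewrite !mulr_sumr -big_split/=; apply: eq_bigr => q _.
  by rewrite expr0 expr1; field.
move=> /(_ half01 (Knu _ _ nu0E) (Knu _ _ nu1E)).
have subA : B i0 `<=` A i0.+1 by rewrite AS.
(* On [B i0] the two measures are [mu] times [1 + eps * a i0] and [1 - eps * a i0]; as [mu (B i0)]
   is positive, their equality forces [a i0 = 0]. *)
rewrite (reweighting_sub tA nu0E (ltn_ord (lift ord0 i0)) (mB i0) subA).
rewrite (reweighting_sub tA nu1E (ltn_ord (lift ord0 i0)) (mB i0) subA).
have := posB i0; rewrite -[mu (B i0)]fineK ?fin_num_measure// lte_fin => pos.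
rewrite -!EFinM => -[] /(mulIf (lt0r_neq0 pos)) /=.
rewrite valK /= expr0 expr1 => aE.
have /eqP : eps * a i0 = 0 by lra.
by rewrite mulf_eq0 (gt_eqF eps_gt0)/= => /eqP.
Qed.

(** * Linear independence of rows, in coordinates *)

Lemma row_indep_leq (F : fieldType) (m k : nat) (v : 'I_m -> 'I_k -> F) :
  (forall a : 'I_m -> F, (forall j, \sum_(i < m) a i * v i j = 0) ->
    forall i, a i = 0) ->
  (m <= k)%N.
Proof.
move=> indep; pose V := \matrix_(i, j) v i j.
suff /eqP <- : row_free V by apply: rank_leq_col.
apply: inj_row_free => a aV0; apply/rowP => i; rewrite mxE.
apply: (indep (a 0)) => j; have /rowP/(_ j) := aV0; rewrite !mxE => av0; rewrite -[RHS]av0.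
by apply: eq_bigr => l _; rewrite !mxE.
Qed.

Lemma free_rowsP (F : fieldType) (m k : nat) (v : 'I_m -> 'I_k -> F) :
  free [tuple (\row_(j < k) v i j : 'rV[F]_k) | i < m] <->
  (forall a : 'I_m -> F, (forall j, \sum_(i < m) a i * v i j = 0) ->
    forall i, a i = 0).
Proof.
have sumE (a : 'I_m -> F) (j : 'I_k) :
    (\sum_(i < m) a i *: [tuple (\row_(j < k) v i j : 'rV[F]_k) | i < m]`_i) 0 j
    = \sum_(i < m) a i * v i j.
  by rewrite summxE; apply: eq_bigr => i _; rewrite nth_mktuple !mxE.
split=> [/freeP indep a a0|indep].
  by apply: indep; apply/rowP => j; rewrite sumE a0 mxE.
by apply/freeP => a /rowP a0; apply: indep => j; rewrite -sumE a0 mxE.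
Qed.

(** * Finite measures carried by finitely many measurable points *)

Section finitely_supported.
Context d (T : measurableType d) (R : realType).
Variables (m : nat) (s : 'I_m -> T).
Hypotheses (meas1 : forall x : T, measurable [set x]) (s_inj : injective s).

Let trivIset_s (D : set 'I_m) : trivIset D (fun i => [set s i]).
Proof.
apply/trivIsetP => i j _ _ ij; rewrite -subset0 => x [/= ->] /s_inj/eqP.
exact/negP.
Qed.

Lemma measurable_range_ord : measurable (range s).
Proof.
have -> : range s = \bigcup_i [set s i].
  by rewrite eqEsubset; split=> x [i _ sx]; exists i.
by apply: fin_bigcup_measurable => //; exact: finite_finset.
Qed.

Variable mu : {finite_measure set T -> \bar R}.
Hypothesis mu0 : mu (~` range s) = 0%E.

Let range_bigsetU : range s = \big[setU/set0]_(i <- index_enum 'I_m) [set s i].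
Proof.
rewrite -bigcup_seq eqEsubset; split=> x [i _ sx]; exists i => //=.
by rewrite mem_index_enum.
Qed.

(** Off [range s] the set [B] is null, and inside it [B] is the disjoint union of its intersections
    with the points [s i], each a singleton or empty. *)
Lemma finitely_supportedE B : measurable B ->
  mu B = (\sum_(i < m) (fine (mu [set s i]))%:E * \d_(s i) B)%E.
Proof.
move=> mB; have mr := measurable_range_ord.
rewrite -[in LHS](setUIDK B (range s)) measureU//; last 3 first.
- exact: measurableI.
- exact: measurableD.
- by rewrite -subset0 => x [[_ rx] [_ /(_ rx)]].
rewrite [X in (_ + X)%E](_ : _ = 0%E); last first.
  apply: (subset_measure0 _ (measurableC mr) _ mu0); first exact: measurableD.
  by move=> x [].
rewrite adde0 range_bigsetU big_distrr/=.
rewrite -(bigcup_seq _ (fun i => B `&` [set s i])).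
rewrite measure_fin_bigcup; last 3 first.
- exact: finite_seq.
- exact/trivIset_setIl/trivIset_s.
- by move=> i _; apply: measurableI.
rewrite -fsbig_seq ?index_enum_uniq//; apply: eq_bigr => i _.
rewrite diracE fineK ?fin_num_measure//.
have [sB|sB] := boolP (s i \in B).
  by rewrite mule1 setIidr// => x ->; rewrite inE in sB.
rewrite mule0 (_ : _ `&` _ = set0) ?measure0// -subset0 => x [Bx] xs.
by move: sB; rewrite -xs notin_setE.
Qed.

Lemma integral_finitely_supported (g : T -> R) :
  mu.-integrable setT (EFin \o g) ->
  (\int[mu]_x (g x)%:E = (\sum_(i < m) fine (mu [set s i]) * g (s i))%:E)%E.
Proof.
move=> ig; have mr := measurable_range_ord; have mg := measurable_int _ ig.
rewrite (negligible_integral (measurableC mr))//.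
rewrite setTD setCK range_bigsetU integral_bigsetU_EFin; last 4 first.
- by move=> i; exact: meas1.
- exact: index_enum_uniq.
- exact: trivIset_s.
- exact: measurable_funTS.
rewrite -sumEFin; apply: eq_bigr => i _.
rewrite (eq_integral (cst (g (s i))%:E)); last by move=> x; rewrite inE => ->.
by rewrite integral_cst// EFinM fineK ?fin_num_measure// muleC.
Qed.

End finitely_supported.

Lemma discrete_extreme d (T : measurableType d) (R : realType) (k : nat)
    (f : 'I_k -> T -> R) (c : 'rV[R]_k) :
  (forall x : T, measurable [set x]) ->
  discrete_measures f `&` moment_measures f c `<=`
  extreme_points (moment_measures f c).
Proof.
move=> meas1 mu [[m [a [s [_ _ sfree muE]]]] Kmu]; split=> // t nu0 nu1 t01 K0 K1.
(* A free family has no repetition, so the vectors [f (s i)], and a fortiori the points, are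
   distinct. *)
have s_inj : injective s.
  have /tuple_uniqP uq := free_uniq sfree.
  by move=> i j sij; apply: uq; rewrite !tnth_mktuple sij.
have mr := measurable_range_ord s meas1.
have mu0 : mu (~` range s) = 0%E.
  rewrite muE; last exact: measurableC.
  rewrite big1// => i _; rewrite diracE (_ : _ \in _ = false) ?mule0//.
  by apply/negbTE; rewrite notin_setE => /=; apply; exists i.
move=> /(_ _ (measurableC mr)); rewrite mu0 => nu_eq.
case/andP: t01 => t0 t1.
have {nu_eq} [nu00 nu10] : nu0 (~` range s) = 0%E /\ nu1 (~` range s) = 0%E.
  (* A vanishing sum of nonnegative terms has vanishing terms, and both coefficients are nonzero. *)
  have /andP[] : ((1 - t)%:E * nu0 (~` range s) == 0)%E &&
      (t%:E * nu1 (~` range s) == 0)%E.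
    by rewrite -padde_eq0 ?nu_eq// mule_ge0// lee_fin ?subr_ge0 ltW.
  rewrite !mule_eq0 !eqe subr_eq0 (gt_eqF t1) (gt_eqF t0)/=.
  by move=> /eqP -> /eqP ->.
(* Both measures have moments [c], so the differences of their weights form a linear relation
   between the [f (s i)]. *)
have eqw i : fine (nu0 [set s i]) - fine (nu1 [set s i]) = 0.
  move/free_rowsP: sfree i; apply => j.
  under eq_bigr do rewrite mulrBl.
  rewrite sumrB; apply/eqP; rewrite subr_eq0; apply/eqP.
  have [i0 e0] := K0 j; have [i1 e1] := K1 j.
  have E0 := integral_finitely_supported meas1 s_inj nu00 i0.
  have E1 := integral_finitely_supported meas1 s_inj nu10 i1.
  exact: (EFin_inj (etrans (esym E0) (etrans (etrans e0 (esym e1)) E1))).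
move=> B mB; rewrite (finitely_supportedE meas1 s_inj nu00 mB).
rewrite (finitely_supportedE meas1 s_inj nu10 mB).
by apply: eq_bigr => i _; rewrite (subr0_eq (eqw i)).
Qed.

(** * Balls, Borel sets and the support in a metric space *)

Section metric_borel.
Context (R : realType) (S : ptopologicalType) (dist : S -> S -> R).
Hypothesis dist_compat : compatible_metric dist.

Local Notation dball x e := [set y | dist x y < e].

(** Nonnegativity is not an axiom of [compatible_metric]; it comes from the triangle inequality
    along [x], [y], [x]. *)
Lemma dist_ge0 x y : 0 <= dist x y.
Proof.
case: dist_compat => d0 dC dD _.
have : dist x x = 0 by apply/d0.
by have := dD x y x; rewrite (dC y x); lra.
Qed.

Lemma dball_center x e : 0 < e -> dball x e x.
Proof. by case: dist_compat => d0 _ _ _ e0 /=; have /d0 -> : x = x by []. Qed.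

Lemma open_dball x e : open (dball x e).
Proof.
case: dist_compat => _ _ dD dnbhs; rewrite openE => y /= xy.
apply/dnbhs; exists (e - dist x y); first by rewrite subr_gt0.
by move=> z /=; have := dD x y z; lra.
Qed.

Lemma measurable_dball x e : measurable (dball x e : set (borel S)).
Proof. by apply: sub_sigma_algebra; apply: open_dball. Qed.

Lemma measurable_set1_borel (x : borel S) : measurable [set x].
Proof.
case: dist_compat => d0 dC dD dnbhs.
rewrite -[X in measurable X]setCK; apply: measurableC.
apply: sub_sigma_algebra; rewrite openE => y /= yx; apply/dnbhs.
exists (dist y x).
  by rewrite lt_neqAle dist_ge0 andbT eq_sym; apply/eqP => /d0.
by move=> z /= + zx; rewrite zx ltxx.
Qed.

Lemma trivIset_dball (n : nat) (s : 'I_n -> S) : injective s ->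
  exists2 e : R, 0 < e & trivIset setT (fun i => dball (s i) e).
Proof.
case: dist_compat => d0 dC dD _ s_inj.
(* The least distance between distinct points of the family; the default 1 covers families with no
   such pair. Balls of radius [r / 2] are then disjoint. *)
pose r := \big[Num.min/1]_(p : 'I_n * 'I_n | p.1 != p.2) dist (s p.1) (s p.2).
have r_gt0 : 0 < r.
  apply: lt_bigmin => // -[i j] /= ij.
  rewrite lt_neqAle dist_ge0 andbT eq_sym; apply/eqP => /d0 /s_inj /eqP.
  exact/negP.
exists (r / 2); first by rewrite divr_gt0.
apply/trivIsetP => i j _ _ ij; rewrite -subset0 => y [/= iy jy].
have : r <= dist (s i) (s j).
  exact: (@bigmin_le_cond _ _ _ 1 (i, j) _ (fun p => dist (s p.1) (s p.2))).
by have := dD (s i) y (s j); rewrite (dC y); lra.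
Qed.

Variable mu : {finite_measure set (borel S) -> \bar R}.

Definition support : set S :=
  [set x | forall U : set (borel S), @open S U -> U x -> (0 < mu U)%E].

(** Each point off the support lies in a null ball of radius [r n] centred in the countable dense
    set [D], and there are only countably many such balls. *)
Lemma negligible_support_compl :
  separable_space S -> mu.-negligible (~` support).
Proof.
case: dist_compat => d0 dC dD dnbhs [D /countable_injP[g g_inj] Ddense].
pose r (n : nat) : R := n.+1%:R^-1.
(* [g] numbers the points of [D]: [F k n] is the ball of radius [r n] around the point numbered [k]
   if such a null ball exists, and is empty otherwise. *)
pose F k n := [set y | exists x,
  [/\ D x, g x = k, mu (dball x (r n)) = 0%E & dball x (r n) y]].
apply: (@negligibleS _ _ _ mu (\bigcup_k \bigcup_n F k n)); last first.
  apply: negligible_bigcup => k; apply: negligible_bigcup => n.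
  have [[x [Dx gx mux]]|noF] := pselect (exists x,
      [/\ D x, g x = k & mu (dball x (r n)) = 0%E]).
    exists (dball x (r n)); split => //; first exact: measurable_dball.
    move=> y [x' [Dx' gx' _ x'y]]; rewrite (g_inj x x') ?inE//.
    by rewrite gx gx'.
  exists set0; split => // y [x [Dx gx mux _]]; apply: noF; by exists x.
move=> y /existsNP[U /not_implyP[oU /not_implyP[Uy /negP]]].
rewrite lt0e measure_ge0 andbT negbK => /eqP muU.
have /dnbhs[e e0 eU] : nbhs y U by apply: open_nbhs_nbhs.
(* With [r n < e / 2], a ball of radius [r n] that contains [y] stays within distance [e] of [y],
   hence inside [U]. *)
have [n rn] : exists n, r n < e / 2.
  exists (Num.trunc (e / 2)^-1); rewrite /r invf_plt ?posrE ?divr_gt0//.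
  exact: truncnS_gt.
have [] := Ddense (dball y (r n)).
- by exists y; apply: dball_center; rewrite invr_gt0.
- exact: open_dball.
move=> x [/= yx Dx]; exists (g x) => //; exists n => //; exists x.
split=> //; last by rewrite /= dC.
apply: (subset_measure0 (measurable_dball _ _) (sub_sigma_algebra oU) _ muU).
move=> z /= xz; apply: eU => /=.
by have := dD y x z; lra.
Qed.

End metric_borel.

(** * Extreme measures have a finite support with independent vectors *)

Theorem corollary11 (R : realType) (S : ptopologicalType)
    (S_polish : polish_space R S) (k : nat) (k_ge1 : (1 <= k)%N)
    (f : 'I_k -> borel S -> R)
    (f_borel : forall j : 'I_k, measurable_fun setT (f j)) :
  forall c : 'rV[R]_k,
    extreme_points (moment_measures f c) =
    discrete_measures f `&` moment_measures f c.
Proof.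
move=> c; have [S_sep [dist dist_compat _]] := S_polish.
have meas1 := measurable_set1_borel dist_compat.
apply/seteqP; split; last exact: discrete_extreme.
move=> mu exmu; have Kmu := exmu.1; split=> //.
have size_le n (s : 'I_n -> S) : injective s ->
    (forall i, support mu (s i)) -> (n <= k)%N.
  move=> s_inj s_supp; have [e e0 tB] := trivIset_dball dist_compat s_inj.
  pose B i : set (borel S) := [set y | dist (s i) y < e].
  have mB i : measurable (B i) by apply: measurable_dball.
  pose v i j := fine (\int[mu]_(x in B i) (f j x)%:E)%E.
  apply: (row_indep_leq (v := v)) => a a0.
  apply: (extreme_moments_indep exmu mB tB _ a0) => i.
  apply: s_supp; first exact: open_dball.
  exact: (dball_center dist_compat).
pose P n :=
  `[< exists s : 'I_n -> S, injective s /\ forall i, support mu (s i) >].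
have exP : exists n, P n.
  by exists 0%N; apply/asboolP; exists (fun=> point); split=> -[].
have ubP n : P n -> (n <= k)%N by move=> /asboolP[s [? ?]]; exact: (size_le n s).
(* A longest injective family of support points exhausts the support, since any further point would
   extend it. *)
case: (ex_maxnP exP ubP) => m /asboolP[s [s_inj s_supp]] m_max.
have supp_sub : support mu `<=` range s.
  move=> x suppx; apply: contrapT => xs.
  suff /m_max : P m.+1 by rewrite ltnn.
  apply/asboolP; exists (fun i => oapp s x (unlift ord0 i)); split=> [i j|i].
    case: unliftP => [i'|] ->; case: unliftP => [j'|] -> //=.
    - by move/s_inj ->.
    - by move=> six; exfalso; apply: xs; exists i'.
    - by move=> xsj; exfalso; apply: xs; exists j'.
  by case: unliftP => [i'|] _; [exact: s_supp|exact: suppx].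
have mr := @measurable_range_ord _ (borel S) _ s meas1.
have mu0 : mu (~` range s) = 0%E.
  apply/negligibleP; first exact: measurableC.
  by apply: negligibleS (negligible_support_compl dist_compat mu S_sep) => x;
    apply: contra_not => /supp_sub.
have pos i : (0 < mu [set s i])%E.
  have [e e0 tB] := trivIset_dball dist_compat s_inj.
  have mB := measurable_dball dist_compat (s i) e.
  have : (0 < mu [set y | (dist (s i) y < e)%R])%E.
    apply: s_supp; first exact: open_dball.
    exact: (dball_center dist_compat).
  move=> /lt_le_trans; apply.
  (* Up to the null complement of [range s], the ball around [s i] is contained in [[set s i]],
     because disjointness of the balls keeps the other points out. *)
  rewrite -(measureU0 (meas1 (s i)) (measurableC mr) mu0).
  apply: le_measure; rewrite ?inE//.
    by apply: measurableU => //; exact: measurableC.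
  move=> x /= six; have [[j _ sjx]|] := pselect (range s x); last by right.
  left; rewrite -sjx; congr s; apply: contrapT => /eqP ji.
  move/trivIsetP: tB => /(_ j i I I ji); rewrite -subset0 => /(_ x); apply.
  split=> //=; rewrite sjx.
  exact: (dball_center dist_compat).
have fin1 i : mu [set s i] \is a fin_num by rewrite fin_num_measure.
have indep a :
    (forall j, \sum_(i < m) a i * f j (s i) = 0) -> forall i, a i = 0.
  (* The integral of [f j] over [[set s i]] is [f j (s i)] times the mass of [s i]; dividing by that
     mass turns a relation between the vectors into one between the integrals. *)
  move=> a0 i; pose b i := a i / fine (mu [set s i]).
  have wpos l : 0 < fine (mu [set s l]) by rewrite -lte_fin fineK.
  suff /eqP : b i = 0.
    by rewrite mulf_eq0 invr_eq0 (gt_eqF (wpos i)) orbF => /eqP.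
  apply: (extreme_moments_indep exmu (fun l => meas1 (s l)) _ pos).
    apply/trivIsetP => p q _ _ pq; rewrite -subset0 => x [/= ->] /s_inj/eqP.
    exact/negP.
  move=> j; rewrite -[RHS](a0 j); apply: eq_bigr => l _.
  rewrite (eq_integral (cst (f j (s l))%:E)); last first.
    by move=> x; rewrite inE => ->.
  by rewrite integral_cst// fineM//= /b mulrA mulrAC divfK// gt_eqF.
exists m, (fun i => fine (mu [set s i])), s; split.
- exact: size_le s_inj s_supp.
- by move=> i; rewrite -lte_fin fineK.
- exact/free_rowsP.
- by move=> B mB; rewrite (finitely_supportedE meas1 s_inj mu0 mB).
Qed.
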